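(* Let $d>2$ be a prime and $n\ge1$. Let $\mathcal P$ be the generalized Pauli group on $n$ qudits of dimension $d$ and let $$G=\{U\in U(d^n):U\mathcal PU^\dagger=\mathcal P\}$$ be the generalized Clifford group, with unitaries identified up to global phase (so that $G$ is finite). Then $G$ is a unitary $2$-design on $(\mathbb C^d)^{\otimes n}$, i.e. for every balanced polynomial $p(U,U^* )$ of degree at most $2$, $$\frac1{|G|}\sum_{U\in G}p(U,U^* )=\int dU\,p(U,U^* ),$$ where the integral is over the normalized Haar measure on the unitary group $U(d^n)$.
   Context: On $\mathbb C^d$ with basis $|z\rangle$, $z\in\mathbb Z_d$, and $\omega=e^{2\pi i/d}$: $X|z\rangle=|z+1\rangle$ (mod $d$), $Z|z\rangle=\omega^z|z\rangle$; $X_j,Z_j$ act on the $j$th qudit. The generalized Pauli group is $\mathcal P=\{\omega^\eta X_1^{a_1}Z_1^{b_1}\cdots X_n^{a_n}Z_n^{b_n}:\eta,a_j,b_j\in\mathbb Z_d\}$. A balanced polynomial $p(U,U^* )$ of degree at most $t$ is a polynomial in the matrix entries of $U$ and of $U^*$ in which each term has the same degree ($\le t$) in the entries of $U$ as in those of $U^*$; its value is unchanged when $U$ is multiplied by a global phase. *)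

(* Defs.v *)
From HB Require Import structures.
From mathcomp Require Import all_boot all_order all_algebra spectral complex.
From mathcomp Require Import all_classical all_reals all_analysis.
From mathcomp Require Import finmap.
From mathcomp Require mpoly.

Set Implicit Arguments.
Unset Strict Implicit.
Unset Printing Implicit Defensive.

Import Order.TTheory GRing.Theory Num.Theory numFieldNormedType.Exports.
(* The notations of mpoly are incompatible with those of MathComp-Analysis. *)
Import -(notations) mpoly.

Local Open Scope classical_set_scope.
Local Open Scope complex_scope.
Local Open Scope ring_scope.
Local Open Scope sesquilinear_scope.

(* R[i] packed as a numClosedFieldType: the norm topology of MathComp-Analysis
   is attached to the structure, it is not inferred from the bare type R[i]. *)
Definition Cplx (R : realType) : numClosedFieldType := R[i].

Definition unitary (R : realType) (N : nat) : Type :=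
  {U : 'M[Cplx R]_N | U \is unitarymx}.

HB.instance Definition _ (R : realType) (N : nat) :=
  Choice.on (unitary R N).

Fact unitary1 (R : realType) (N : nat) :
  (1%:M : 'M[Cplx R]_N) \is unitarymx.
Proof. by apply/unitarymxP; rewrite trmx1 map_mx1 mulmx1. Qed.

HB.instance Definition _ (R : realType) (N : nat) :=
  isPointed.Build (unitary R N) (exist _ 1%:M (unitary1 R N)).

Definition umul (R : realType) (N : nat) (V U : unitary R N) : unitary R N :=
  exist _ (sval V *m sval U) (mul_unitarymx (svalP V) (svalP U)).

(* U(N) with the topology induced by that of the matrix space... *)
Definition unitary_top (R : realType) (N : nat) : topologicalType :=
  initial_topology (fun U : unitary R N => sval U).

(* ... and with the corresponding Borel sigma-algebra. *)
Definition unitary_borel (R : realType) (N : nat) :=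
  g_sigma_algebraType (@open (unitary_top R N)).

(* On the compact group U(N) a left-invariant Borel probability measure is the
   normalized (two-sided) Haar measure. *)
Definition haar_measure (R : realType) (N : nat)
    (mu : probability (unitary_borel R N) R) : Prop :=
  forall (V : unitary R N) (A : set (unitary_borel R N)),
    measurable A -> mu [set umul V U | U in A] = mu A.

Definition cintegral (R : realType) d (T : measurableType d)
    (mu : {measure set T -> \bar R}) (f : T -> Cplx R) : Cplx R :=
  (\int[mu]_(x in setT) complex.Re (f x))
    +i* (\int[mu]_(x in setT) complex.Im (f x)).

(* The first N * N variables stand for the entries of U, the last N * N ones for
   their complex conjugates, both in the order of mxvec. *)
Definition entry_poly (R : realType) (N : nat) :=
  mpoly (N * N + N * N) (Cplx R).

Definition balanced (R : realType) (N t : nat) (p : entry_poly R N) : Prop :=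
  forall m, m \in msupp p ->
    let degU := (\sum_(k < N * N) m (lshift (N * N) k))%N in
    let degUs := (\sum_(k < N * N) m (rshift (N * N) k))%N in
    degU = degUs /\ (degU <= t)%N.

Definition poly_val (R : realType) (N : nat) (p : entry_poly R N)
    (U : unitary R N) : Cplx R :=
  meval (row_mx (mxvec (sval U)) (mxvec (map_mx Num.conj (sval U))) 0) p.

Definition phase_class (R : realType) (N : nat) (U : unitary R N) :
    set (unitary R N) :=
  [set V | exists2 c : Cplx R, `|c| = 1 & sval V = c *: sval U].

(* G is a set of unitaries up to global phase, i.e. of phase classes; a balanced
   polynomial is evaluated on a class through any choice rep of representatives.
   The finitely supported sum is the sum over G when G is finite. *)
Definition unitary_design (R : realType) (N t : nat)
    (mu : probability (unitary_borel R N) R)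
    (G : set (set (unitary R N))) : Prop :=
  forall p : entry_poly R N, balanced t p ->
  forall rep : set (unitary R N) -> unitary R N, (forall K, G K -> K (rep K)) ->
    #|` fset_set G|%:R^-1 * (\sum_(K \in G) poly_val p (rep K))
      = cintegral mu (fun U : unitary_borel R N => poly_val p U).

(* z stands for the basis vector |z_1> ... |z_n> of the n-qudit space. *)
Definition qbasis (d n : nat) := {ffun 'I_n -> 'Z_d}.

Definition qdim (d n : nat) : nat := #|{: qbasis d n}|.

Lemma qdimE (d n : nat) : (1 < d)%N -> qdim d n = (d ^ n)%N.
Proof. by move=> d1; rewrite /qdim card_ffun !card_ord Zp_cast. Qed.

Definition qket (d n : nat) (r : 'I_(qdim d n)) : qbasis d n := enum_val r.

Definition omega (R : realType) (d : nat) : Cplx R :=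
  cos (2 * pi / d%:R) +i* sin (2 * pi / d%:R).

(* One-qudit operators; rows and columns are indexed by 'Z_d itself. *)
Definition pauliX (R : realType) (d : nat) : 'M[Cplx R]_((Zp_trunc d).+2) :=
  \matrix_(y, z) ((y : 'Z_d) == z + 1)%:R.

Definition pauliZ (R : realType) (d : nat) : 'M[Cplx R]_((Zp_trunc d).+2) :=
  \matrix_(y, z) (omega R d ^+ z *+ (y == z)).

(* A acting on the j-th tensor factor, the identity on the others. *)
Definition on_qudit (R : realType) (d n : nat) (j : 'I_n)
    (A : 'M[Cplx R]_((Zp_trunc d).+2)) : 'M[Cplx R]_(qdim d n) :=
  \matrix_(r, c)
    (A (qket r j) (qket c j) *+
       [forall k, (k != j) ==> (qket r k == qket c k)]).

Definition pauli_group (R : realType) (d n : nat) :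
    set 'M[Cplx R]_(qdim d n) :=
  [set P | exists (eta : 'Z_d) (a b : {ffun 'I_n -> 'Z_d}),
     P = omega R d ^+ eta *:
         \prod_(j < n) (on_qudit j (pauliX R d) ^+ a j *
                        on_qudit j (pauliZ R d) ^+ b j)].
Arguments pauli_group : clear implicits.

Definition clifford (R : realType) (d n : nat) : set (unitary R (qdim d n)) :=
  [set U | [set sval U *m P *m (sval U)^t* | P in pauli_group R d n]
           = pauli_group R d n].
Arguments clifford : clear implicits.

Definition clifford_group (R : realType) (d n : nat) :
    set (set (unitary R (qdim d n))) :=
  [set phase_class U | U in clifford R d n].
Arguments clifford_group : clear implicits.

(* Main.v *)
Require Import Defs.
From mathcomp Require Import all_boot all_order all_algebra.
From mathcomp Require Import all_classical all_reals all_analysis.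
From mathcomp Require Import spectral complex finmap ring measurable_realfun.
From mathcomp Require mpoly.

(** Let [D f] be the average of [f] over the Clifford group minus its Haar
integral. Both averages are normalized and invariant under left multiplication
by Clifford unitaries, so for fixed [A], [B] the linear map
[L M = D (U |-> (U A U^* ) tr (U B U^* M))] commutes with conjugation by
Cliffords. Covariance under the Weyl operators [W_u] forces [L W_u = c_u W_u].
The quadratic Clifford unitaries [sum_k omega^(s k^2) Pi_k], where the [Pi_k]
are the spectral projections of [W_u], act on phase space by symplectic
transvections, which are transitive on nonzero vectors; hence [c_u = c] for
[u <> 0]. The identities [tr (L 1) = 0] and [sum_ij (L E_ij)_ij = 0], which hold
because [D] kills constants, make the two remaining constants [c] and [c_0]
vanish, so [L = 0]. By unitarity every balanced monomial of
degree at most 2 is an entry of such an [L]. *)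

Set Implicit Arguments.
Unset Strict Implicit.
Unset Printing Implicit Defensive.

Import Order.TTheory GRing.Theory Num.Theory numFieldNormedType.Exports.
Import -(notations) mpoly.

Local Open Scope classical_set_scope.
Local Open Scope complex_scope.
Local Open Scope ring_scope.
Local Open Scope sesquilinear_scope.

(** * Characters of Z/d *)

Section Phase.
Variables (R : realType) (d : nat).
Hypotheses (d_prime : prime d) (d_gt2 : (2 < d)%N).

Lemma omegaX k : omega R d ^+ k =
  cos ((2 * pi / d%:R) * k%:R) +i* sin ((2 * pi / d%:R) * k%:R).
Proof.
elim: k => [|k IHk]; first by rewrite expr0 mulr0 cos0 sin0.
have -> : 2 * pi / d%:R * k.+1%:R = 2 * pi / d%:R + 2 * pi / d%:R * k%:R :> R.
  by rewrite -[k.+1]add1n natrD mulrDr mulr1.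
rewrite exprS IHk cosD sinD.
by apply/eqP; rewrite eq_complex /=; apply/andP; split; apply/eqP; ring.
Qed.

Lemma omega_order : omega R d ^+ d = 1.
Proof.
rewrite omegaX mulfVK ?pnatr_eq0 -?lt0n ?prime_gt0 //.
by rewrite mulr_natl cos2pi sin2pi.
Qed.

(** As d > 2, the angle 2 pi / d lies strictly between 0 and pi, so its sine, the imaginary part of
    omega, is positive. *)
Lemma omega_neq1 : omega R d != 1.
Proof.
apply/eqP => /(congr1 (@complex.Im R)) /= /eqP; apply/negP.
rewrite gt_eqF // sin_gt0_pi //.
have d0 : (0 : R) < d%:R by rewrite ltr0n prime_gt0.
rewrite divr_gt0 ?mulr_gt0 ?pi_gt0 //= ltr_pdivrMr // mulrC ltr_pM2l ?pi_gt0 //.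
by rewrite ltr_nat.
Qed.

Lemma omega_conj : omega R d * (omega R d)^* = 1.
Proof.
apply/eqP; rewrite eq_complex /=; apply/andP; split; apply/eqP; last by ring.
rewrite -[RHS](cos2Dsin2 (2 * pi / d%:R)); ring.
Qed.

Definition chi (x : 'Z_d) : Cplx R := omega R d ^+ x.

Lemma chi_nat k : chi k%:R = omega R d ^+ k.
Proof.
rewrite /chi; have d1 := prime_gt1 d_prime.
by rewrite val_Zp_nat // expr_mod // omega_order.
Qed.

Lemma chiD x y : chi (x + y) = chi x * chi y.
Proof.
rewrite -[x]natr_Zp -[y]natr_Zp -natrD !chi_nat -exprD.
by [].
Qed.

Lemma chi0 : chi 0 = 1.
Proof. by rewrite /chi expr0. Qed.

Lemma chi_unit x : chi x * (chi x)^* = 1.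
Proof. by rewrite /chi rmorphXn -exprMn omega_conj expr1n. Qed.

Lemma chi_neq0 x : chi x != 0.
Proof.
apply/eqP => h; have := chi_unit x; rewrite h mul0r => /esym/eqP.
by rewrite oner_eq0.
Qed.

Lemma chi_conj x : (chi x)^* = chi (- x).
Proof.
apply: (mulfI (chi_neq0 x)); by rewrite chi_unit -chiD subrr chi0.
Qed.

Lemma Zd_unit (x : 'Z_d) : x != 0 -> x \is a GRing.unit.
Proof.
move=> x0; rewrite -[x]natr_Zp unitZpE ?prime_gt1 // prime_coprime //.
apply: contra x0 => dx; rewrite -[x]natr_Zp.
by apply/eqP/val_inj; rewrite /= val_Zp_nat ?prime_gt1 //; apply/eqP.
Qed.

Lemma two_unit : (2 : 'Z_d) \is a GRing.unit.
Proof.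
rewrite unitZpE ?prime_gt1 // prime_coprime //.
by apply/negP => /dvdn_leq => /(_ isT); rewrite leqNgt d_gt2.
Qed.

(** Since d is prime, a nonzero [x] is invertible, so omega is a power of [chi x] and would be 1 as
    well. *)
Lemma chi_eq1 x : chi x = 1 -> x = 0.
Proof.
move=> h; apply/eqP/negPn/negP => /Zd_unit ux; move/eqP: omega_neq1; apply.
have chiX k y : chi (y *+ k) = chi y ^+ k.
  by elim: k => [|k IH]; rewrite ?chi0 // mulrS chiD IH exprS.
rewrite -[LHS]expr1 -chi_nat mulr1n -(divrr ux) mulrC -[x^-1]natr_Zp mulr_natl.
by rewrite chiX h expr1n.
Qed.

(** Reindexing by the bijection [h] multiplies the sum by [chi c], which is not 1. *)
Lemma chi_sum (T : finType) (f : T -> 'Z_d) (h : T -> T) (c : 'Z_d) :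
  injective h -> c != 0 -> (forall x, f (h x) = c + f x) ->
  \sum_(x : T) chi (f x) = 0.
Proof.
move=> h_inj c0 fh; apply/eqP.
have : (1 - chi c) * (\sum_(x : T) chi (f x)) = 0.
  rewrite mulrBl mul1r mulr_sumr [X in X - _](reindex_inj h_inj) /=.
  apply/eqP; rewrite subr_eq0; apply/eqP/eq_bigr => x _.
  by rewrite fh chiD.
move/eqP; rewrite mulf_eq0 subr_eq0 => /orP[/eqP hc|//].
by rewrite (chi_eq1 (esym hc)) eqxx in c0.
Qed.

Lemma chi_sumZ (k : 'Z_d) : \sum_(j : 'Z_d) chi (j * k) = d%:R *+ (k == 0).
Proof.
have [->|k0] := eqVneq k 0.
  under eq_bigr do rewrite mulr0 chi0.
  by rewrite sumr_const card_ord Zp_cast ?prime_gt1.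
apply: (@chi_sum _ (fun j => j * k) (+%R 1) k) => [|//|j]; first exact: addrI.
by rewrite mulrDl mul1r.
Qed.
End Phase.

(** * Weyl operators and transvections *)

Section Weyl.
Variables (R : realType) (d n : nat).
Hypotheses (d_prime : prime d) (d_gt2 : (2 < d)%N).

Notation N := (qdim d n).
Notation chi := (@chi R d).
Notation Q := (qbasis d n).

Definition qdot (a b : Q) : 'Z_d := \sum_j a j * b j.

Lemma qdotC a b : qdot a b = qdot b a.
Proof. by apply: eq_bigr => j _; rewrite mulrC. Qed.

Lemma qdotDr a b c : qdot a (b + c) = qdot a b + qdot a c.
Proof. by rewrite -big_split; apply: eq_bigr => j _; rewrite ffunE mulrDr. Qed.

Lemma qdotDl a b c : qdot (b + c) a = qdot b a + qdot c a.
Proof. by rewrite !(qdotC _ a) qdotDr. Qed.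

Lemma qdotNr a b : qdot a (- b) = - qdot a b.
Proof. by rewrite -sumrN; apply: eq_bigr => j _; rewrite ffunE mulrN. Qed.

Lemma qdotNl a b : qdot (- b) a = - qdot b a.
Proof. by rewrite !(qdotC _ a) qdotNr. Qed.

Lemma qdot0r a : qdot a 0 = 0.
Proof. by apply: big1 => j _; rewrite ffunE mulr0. Qed.

Lemma qdot_neq0 b : b != 0 -> exists a, qdot a b != 0.
Proof.
move=> b0; have [j bj] : exists j, b j != 0.
  apply/existsP; apply: contraR b0; rewrite negb_exists => /forallP b0.
  by apply/eqP/ffunP => j; rewrite ffunE; apply/eqP; have := b0 j; rewrite negbK.
exists [ffun k => (k == j)%:R]; rewrite /qdot (bigD1 j) //= big1 => [|k kj].
  by rewrite ffunE eqxx mul1r addr0.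
by rewrite ffunE (negbTE kj) mul0r.
Qed.

Definition symp (u v : Q * Q) : 'Z_d := qdot u.2 v.1 - qdot u.1 v.2.

Lemma sympDl u v w : symp (u + v) w = symp u w + symp v w.
Proof. rewrite /symp !qdotDl; ring. Qed.

Lemma sympDr u v w : symp w (u + v) = symp w u + symp w v.
Proof. rewrite /symp !qdotDr; ring. Qed.

Lemma sympNr u w : symp w (- u) = - symp w u.
Proof. rewrite /symp !qdotNr; ring. Qed.

Lemma symp0l w : symp 0 w = 0.
Proof. by rewrite /symp !(qdotC 0) !qdot0r subrr. Qed.

Lemma sympxx u : symp u u = 0.
Proof. by rewrite /symp qdotC subrr. Qed.

Lemma symp_antisym u v : symp v u = - symp u v.
Proof. rewrite /symp !(qdotC v.1) !(qdotC v.2); ring. Qed.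

Lemma sympMnl u v k : symp (u *+ k) v = k%:R * symp u v.
Proof.
elim: k => [|k IH]; first by rewrite mulr0n symp0l mul0r.
by rewrite mulrS sympDl IH -[k.+1]add1n natrD mulrDl mul1r.
Qed.

Lemma sympMnr u v k : symp v (u *+ k) = k%:R * symp v u.
Proof. by rewrite symp_antisym sympMnl (symp_antisym u) mulrN. Qed.

Lemma symp_nondeg u : u != 0 -> exists v, symp u v != 0.
Proof.
case: u => a b; rewrite -pair_eqE negb_and /=.
have [-> /= /qdot_neq0[c bc]|/qdot_neq0[c ac] _] := eqVneq a 0.
  by exists (c, 0); rewrite /symp /= qdot0r subr0 qdotC.
by exists (0, c); rewrite /symp /= qdot0r sub0r oppr_eq0 qdotC.
Qed.

(** Two nonzero vectors always have a common [w] orthogonal to neither, so two non-orthogonal steps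
    suffice. This reduces transitivity of the transvections to pairs with nonzero symplectic
    product. *)
Lemma symp_connect (P : Q * Q -> Q * Q -> Prop) :
  (forall u v w, P u v -> P v w -> P u w) ->
  (forall u v, symp u v != 0 -> P u v) ->
  forall u v, u != 0 -> v != 0 -> P u v.
Proof.
move=> Ptrans Pstep u v u0 v0.
suff [w [uw wv]] : exists w, symp u w != 0 /\ symp v w != 0.
  apply: Ptrans (Pstep _ _ uw) (Pstep _ _ _).
  by rewrite symp_antisym oppr_eq0.
have [w1 uw1] := symp_nondeg u0; have [w2 vw2] := symp_nondeg v0.
have [vw1|?] := eqVneq (symp v w1) 0; last by exists w1.
have [uw2|?] := eqVneq (symp u w2) 0; last by exists w2.
(* Each of [w1], [w2] is now orthogonal to the vector it was not chosen for, so neither pairing of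
   the sum can cancel. *)
by exists (w1 + w2); rewrite !sympDr vw1 uw2 addr0 add0r.
Qed.

(** Scalar multiplication on phase space through the representative of [k] in nat; its additivity in
    [k] rests on phase space being d-torsion. *)
Definition zscale (k : 'Z_d) (u : Q * Q) : Q * Q := u *+ k.

Lemma zscale0 u : zscale 0 u = 0.
Proof. by []. Qed.

Lemma sympZl k u v : symp (zscale k u) v = k * symp u v.
Proof. by rewrite sympMnl natr_Zp. Qed.

Lemma sympZr k u v : symp v (zscale k u) = k * symp v u.
Proof. by rewrite sympMnr natr_Zp. Qed.

Lemma zscale1 u : zscale 1 u = u.
Proof. by rewrite /zscale /= mulr1n. Qed.

Lemma zscaleDl (u : Q * Q) (i j : 'Z_d) :
  zscale (i + j) u = zscale i u + zscale j u.
Proof.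
have ud : u *+ d = 0.
  have fd (a : Q) : a *+ d = 0.
    apply/ffunP => k; rewrite ffunMnE ffunE.
    by rewrite -mulr_natr pchar_Zp ?mulr0 ?prime_gt1.
  have E k : u *+ k = (u.1 *+ k, u.2 *+ k).
    elim: k => [|k IH]; first by [].
    by rewrite !mulrS IH.
  by rewrite E !fd.
have um k : u *+ (k %% (Zp_trunc d).+2) = u *+ k.
  rewrite Zp_cast ?prime_gt1 //.
  by rewrite [in RHS](divn_eq k d) mulrnDr mulnC mulrnA ud mul0rn add0r.
by rewrite /zscale -mulrnDr um.
Qed.

Lemma zscaleNl k u : zscale (- k) u = - zscale k u.
Proof.
by apply/eqP; rewrite -subr_eq0 opprK -zscaleDl addNr zscale0.
Qed.

Definition half : 'Z_d := 2^-1.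

Lemma half2 : 2 * half = 1.
Proof. by rewrite /half divrr // two_unit. Qed.

(* X^a Z^b with the phase omega^(a.b/2), which makes [k |-> weyl (k u)] a group
   morphism; this is where d must be odd. *)
Definition weyl (u : Q * Q) : 'M[Cplx R]_N :=
  \matrix_(r, c) (chi (half * qdot u.1 u.2 + qdot u.2 (qket c))
                    *+ (qket r == qket c + u.1)).

Lemma qket_rank (q : Q) : qket (enum_rank q) = q.
Proof. exact: enum_rankK. Qed.

Lemma qket_inj : injective (@qket d n).
Proof. exact: enum_val_inj. Qed.

Lemma weylM u v : weyl u *m weyl v = chi (half * symp u v) *: weyl (u + v).
Proof.
apply/matrixP => r c; rewrite !mxE.
(* Column [c] of [weyl v] has a single nonzero entry, in the row labelled [qket c + v.1]. *)
rewrite (bigD1 (enum_rank (qket c + v.1))) //= !mxE qket_rank eqxx mulr1n.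
rewrite [X in _ + X]big1 ?addr0; last first.
  move=> s sc; rewrite !mxE; case: (qket s =P _) => [E|]; last by rewrite mulr0.
  by case/eqP: sc; apply: qket_inj; rewrite qket_rank.
rewrite mulrnAl mulrnAr -!chiD // -addrA (addrC u.1 v.1).
rewrite -(addrA _ v.1); congr (chi _ *+ _).
rewrite (qdotDr u.2 (qket c) v.1) /symp (qdotDl _ v.1 u.1) (qdotDl _ u.2 v.2).
rewrite (qdotDr _ u.2 v.2) (qdotDr _ u.2 v.2) !(qdotC u.2) !(qdotC v.2).
(* Once 1 is written as [2 * half], the exponents agree with [half] treated as a free variable. *)
rewrite -[X in _ + (_ + X + _) = _]mul1r -half2; ring.
Qed.

Lemma weyl0 : weyl 0 = 1%:M.
Proof.
apply/matrixP => r c; rewrite !mxE /= !(qdotC 0) !qdot0r mulr0 addr0 chi0 addr0.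
by rewrite (inj_eq qket_inj).
Qed.

Lemma weyl_comm u v : weyl u *m weyl v = chi (symp u v) *: (weyl v *m weyl u).
Proof.
rewrite !weylM scalerA -chiD // (addrC v); congr (chi _ *: _).
rewrite (symp_antisym u v) -[X in _ = X + _]mul1r -half2; ring.
Qed.

Lemma weyl_adj u : (weyl u)^t* = weyl (- u).
Proof.
apply/matrixP => r c; rewrite !mxE rmorphMn /= chi_conj //.
rewrite -subr_eq eq_sym; case: eqP => // ->; rewrite !mulr1n; congr chi.
rewrite !qdotDr !qdotNl !qdotNr -[qdot u.2 u.1]mul1r -half2 (qdotC u.2 u.1).
ring.
Qed.

Lemma weylV u : weyl u *m weyl (- u) = 1%:M.
Proof.
by rewrite weylM subrr weyl0 sympNr sympxx oppr0 mulr0 chi0 scale1r.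
Qed.

Lemma weyl_unitary u : weyl u \is unitarymx.
Proof. by apply/unitarymxP; rewrite weyl_adj weylV. Qed.

Lemma qdim_gt0 : (0 < N)%N.
Proof. by apply/card_gt0P; exists 0. Qed.

(** Weyl operators with the same shift part have the same support and differ there by characters of
    the column label, so Fourier inversion over [b] isolates one entry. Hence the Weyl operators
    span all matrices. *)
Lemma delta_weyl r c : delta_mx r c =
  N%:R^-1 *: \sum_(b : Q)
    chi (- (half * qdot (qket r - qket c) b + qdot b (qket c)))
      *: weyl (qket r - qket c, b).
Proof.
have N0 : (N%:R : Cplx R) != 0 by rewrite pnatr_eq0 -lt0n qdim_gt0.
apply/matrixP => i j; rewrite !mxE summxE.
under eq_bigr => b _.
  rewrite !mxE /= mulrnAr -chiD //.
  rewrite opprD addrACA addNr add0r -qdotNr addrC -qdotDr.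
  over.
rewrite sumrMnl addrC -mulr_natr.
have [->|jc] := eqVneq j c.
  rewrite addNr; under eq_bigr do rewrite qdot0r chi0.
  rewrite sumr_const addrC addrNK (inj_eq qket_inj) andbT -[#|_|]/N.
  by rewrite mul1r mulrnAr mulVf.
rewrite andbF mulr0 [X in _ * (X *+ _)](_ : _ = 0) ?mul0rn ?mulr0 //.
(* In any other column the exponent is a nonzero linear form in [b], so the character sum
   vanishes. *)
have [|b0 b0P] := @qdot_neq0 (- qket c + qket j).
  by rewrite addrC subr_eq0 (inj_eq qket_inj).
apply: (chi_sum R d_prime d_gt2 (h := +%R b0) _ b0P) => [|x]; first exact: addrI.
exact: qdotDl.
Qed.

(** Schur's lemma for the Weyl operators: since they span, [Y] commutes with every matrix unit. *)
Lemma weyl_centralizer (Y : 'M[Cplx R]_N) :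
  (forall u, weyl u *m Y = Y *m weyl u) -> exists c, Y = c%:M.
Proof.
move=> YW.
have YE r c : delta_mx r c *m Y = Y *m delta_mx r c.
  rewrite delta_weyl -scalemxAl -scalemxAr mulmx_suml mulmx_sumr.
  by congr (_ *: _); apply: eq_bigr => b _; rewrite -scalemxAl -scalemxAr YW.
pose r0 : 'I_N := Ordinal qdim_gt0.
exists (Y r0 r0); apply/matrixP => i j.
(* The entry at [(r0, j)] is [Y i j] on the left, and on the right [Y r0 r0] if [i = j] and 0
   otherwise. *)
have /matrixP/(_ r0 j) := YE r0 i; rewrite !mxE.
rewrite (bigD1 i) //= big1 ?addr0; last first.
  by move=> k ki; rewrite !mxE (negbTE ki) andbF mul0r.
rewrite (bigD1 r0) //= big1 ?addr0; last first.
  by move=> k ki; rewrite !mxE (negbTE ki) andFb mulr0.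
by rewrite !mxE !eqxx mul1r eq_sym mulr_natr => ->.
Qed.

(** The spectral projection of [weyl u] for the eigenvalue [chi k], obtained by Fourier transform of
    the cyclic group of powers of [weyl u]. *)
Definition weyl_proj (u : Q * Q) (k : 'Z_d) : 'M[Cplx R]_N :=
  d%:R^-1 *: \sum_(j : 'Z_d) chi (j * - k) *: weyl (zscale j u).

Let d0 : (d%:R : Cplx R) != 0.
Proof. by rewrite pnatr_eq0 -lt0n prime_gt0. Qed.

Lemma weylZM u (i j : 'Z_d) :
  weyl (zscale i u) *m weyl (zscale j u) = weyl (zscale (i + j) u).
Proof.
by rewrite weylM sympZl sympZr sympxx !mulr0 chi0 scale1r zscaleDl.
Qed.

Lemma weyl_projM u k l :
  weyl_proj u k *m weyl_proj u l = weyl_proj u k *+ (k == l).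
Proof.
rewrite /weyl_proj -scalemxAl -scalemxAr mulmx_suml.
under eq_bigr => i _.
  rewrite mulmx_sumr.
  under eq_bigr => j _.
    rewrite -scalemxAl -scalemxAr scalerA weylZM -chiD //.
    over.
  (* After this shift the Weyl operator depends on [j] only, and the remaining sum over [i] is a
     character sum that enforces [k = l]. *)
  rewrite (reindex_inj (addrI (- i))) /=.
  under eq_bigr => j _ do rewrite addNKr.
  over.
rewrite exchange_big /=.
under eq_bigr => j _.
  under eq_bigr => i _.
    rewrite (_ : _ + _ = j * - l + i * (l - k)); last by ring.
    rewrite chiD // mulrC -scalerA.
    over.
  rewrite -scaler_suml chi_sumZ // subr_eq0 eq_sym -scalerMnl scalerA.
  over.
rewrite sumrMnl !scalerMnr; case: eqP => [->|_]; last first.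
  by rewrite !mulr0n !scaler0.
rewrite !mulr1n; congr (_ *: _); rewrite scaler_sumr; apply: eq_bigr => j _.
by rewrite !scalerA mulrA mulVf // mul1r.
Qed.

Lemma weyl_proj_fourier u j :
  \sum_(k : 'Z_d) chi (j * k) *: weyl_proj u k = weyl (zscale j u).
Proof.
under eq_bigr => k _.
  rewrite /weyl_proj scalerA mulrC -scalerA scaler_sumr.
  under eq_bigr => i _.
    rewrite scalerA -chiD // (_ : _ + _ = k * (j - i)); last by ring.
    over.
  over.
rewrite -scaler_sumr exchange_big /=.
under eq_bigr => i _ do rewrite -scaler_suml chi_sumZ // subr_eq0.
rewrite (bigD1 j) //= eqxx big1 ?addr0 => [|i ij].
  by rewrite scalerA mulVf // scale1r.
by rewrite eq_sym (negbTE ij) mulr0n scale0r.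
Qed.

Lemma weyl_proj_sum u : \sum_(k : 'Z_d) weyl_proj u k = 1%:M.
Proof.
rewrite -weyl0 -(zscale0 u) -(weyl_proj_fourier u 0).
by apply: eq_bigr => k _; rewrite mul0r chi0 scale1r.
Qed.

Lemma weyl_proj_adj u k : (weyl_proj u k)^t* = weyl_proj u k.
Proof.
rewrite /weyl_proj linearZ /= map_mxZ /= fmorphV /= rmorph_nat; congr (_ *: _).
rewrite linear_sum raddf_sum /= [RHS](reindex_inj oppr_inj) /=.
apply: eq_bigr => j _; rewrite linearZ /= map_mxZ /= chi_conj // weyl_adj.
by rewrite mulNr zscaleNl.
Qed.

(** Passing [weyl v] through [weyl (zscale j u)] costs the phase [chi (j * symp u v)], which
    translates the Fourier index: [weyl v] permutes the eigenspaces of [weyl u]. *)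
Lemma weyl_proj_comm u v k :
  weyl_proj u k *m weyl v = weyl v *m weyl_proj u (k - symp u v).
Proof.
rewrite /weyl_proj -scalemxAl -scalemxAr mulmx_suml mulmx_sumr.
congr (_ *: _); apply: eq_bigr => j _.
rewrite -scalemxAl weyl_comm sympZl -scalemxAr scalerA -chiD //.
by congr (chi _ *: _); ring.
Qed.

Definition transvection (s : 'Z_d) (u : Q * Q) : 'M[Cplx R]_N :=
  \sum_(k : 'Z_d) chi (s * k ^+ 2) *: weyl_proj u k.

Lemma transvection_adj s u : (transvection s u)^t* = transvection (- s) u.
Proof.
rewrite /transvection linear_sum raddf_sum; apply: eq_bigr => k _ /=.
by rewrite linearZ /= map_mxZ /= chi_conj // mulNr weyl_proj_adj.
Qed.

Lemma proj_funM u (f g : 'Z_d -> Cplx R) :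
  (\sum_k f k *: weyl_proj u k) *m (\sum_k g k *: weyl_proj u k)
  = \sum_k (f k * g k) *: weyl_proj u k.
Proof.
rewrite mulmx_suml; apply: eq_bigr => k _.
rewrite mulmx_sumr (bigD1 k) //= big1 ?addr0 => [|l lk].
  by rewrite -scalemxAl -scalemxAr weyl_projM eqxx scalerA.
by rewrite -scalemxAl -scalemxAr weyl_projM eq_sym (negbTE lk) !scaler0.
Qed.

Lemma transvection_unitary s u : transvection s u \is unitarymx.
Proof.
apply/unitarymxP; rewrite transvection_adj proj_funM -[RHS](weyl_proj_sum u).
by apply: eq_bigr => k _; rewrite -chiD // mulNr subrr chi0 scale1r.
Qed.

(** Moving [weyl v] to the left shifts the spectral index of one quadratic phase by [symp u v]. The
    difference of the two quadratics is affine in the index, so what remains is a phase times a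
    power of [weyl u]. On labels this is the symplectic transvection adding [2 * s * symp u v] times
    [u] to [v]. *)
Lemma transvection_weyl s u v :
  transvection s u *m weyl v *m (transvection s u)^t*
  = chi (s * symp u v ^+ 2) *: (weyl v *m weyl (zscale (2 * s * symp u v) u)).
Proof.
rewrite transvection_adj {1}/transvection mulmx_suml.
under eq_bigr => k _ do rewrite -scalemxAl weyl_proj_comm scalemxAr.
rewrite -mulmx_sumr -mulmxA scalemxAr; congr (_ *m _).
rewrite (reindex_inj (addIr (symp u v))) /=.
under eq_bigr => k _ do rewrite addrK.
rewrite proj_funM -weyl_proj_fourier scaler_sumr; apply: eq_bigr => k _.
rewrite [RHS]scalerA -!chiD //.
suff -> : s * (k + symp u v) ^+ 2 + - s * k ^+ 2 =
  s * symp u v ^+ 2 + 2 * s * symp u v * k by [].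
ring.
Qed.
End Weyl.

(** * Bounded Borel functions on the unitary group *)

Section ComplexParts.
Variable R : realType.
Implicit Types (z w : Cplx R).

Lemma ReD z w : complex.Re (z + w) = complex.Re z + complex.Re w.
Proof. by case: z; case: w. Qed.

Lemma ImD z w : complex.Im (z + w) = complex.Im z + complex.Im w.
Proof. by case: z; case: w. Qed.

Lemma ReM z w : complex.Re (z * w) =
  complex.Re z * complex.Re w - complex.Im z * complex.Im w.
Proof. by case: z; case: w. Qed.

Lemma ImM z w : complex.Im (z * w) =
  complex.Re z * complex.Im w + complex.Im z * complex.Re w.
Proof. by case: z; case: w. Qed.

Lemma normr_Re_le z : `|complex.Re z|%:C <= (`|z| : R[i]).
Proof.
case: z => a b; rewrite normc_def lecR /= -sqrtr_sqr ler_wsqrtr //.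
by rewrite lerDl sqr_ge0.
Qed.

Lemma normr_Im_le z : `|complex.Im z|%:C <= (`|z| : R[i]).
Proof.
case: z => a b; rewrite normc_def lecR /= -sqrtr_sqr ler_wsqrtr //.
by rewrite lerDr sqr_ge0.
Qed.

Lemma continuous_Re : continuous (fun z : Cplx R => complex.Re z : R).
Proof.
move=> z A /nbhs_ballP[e e0 eA]; apply/nbhs_ballP; exists (e%:C : Cplx R).
  by rewrite /= ltcR.
move=> w zw; apply: eA; rewrite /ball /= -ltcR.
apply: le_lt_trans zw.
have -> : complex.Re z - complex.Re w = complex.Re (z - w) by case: (z); case: (w).
exact: normr_Re_le.
Qed.

Lemma continuous_Im : continuous (fun z : Cplx R => complex.Im z : R).
Proof.
move=> z A /nbhs_ballP[e e0 eA]; apply/nbhs_ballP; exists (e%:C : Cplx R).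
  by rewrite /= ltcR.
move=> w zw; apply: eA; rewrite /ball /= -ltcR.
apply: le_lt_trans zw.
have -> : complex.Im z - complex.Im w = complex.Im (z - w) by case: (z); case: (w).
exact: normr_Im_le.
Qed.
End ComplexParts.

Lemma continuous_mx (K : numFieldType) (T : topologicalType) (p q : nat)
    (f : T -> 'M[K]_(p, q)) :
  (forall i j, continuous (fun x => f x i j)) -> continuous f.
Proof.
move=> fc x A [P nP sPA].
apply: (@filterS _ (nbhs x) _ [set y | forall i j, P i j (f y i j)]).
  by move=> y Py; exact: sPA.
by apply: filter_forall => i; apply: filter_forall => j; exact: fc (nP i j).
Qed.

Lemma continuous_sum (K : numFieldType) (T : topologicalType) (I : Type)
    (s : seq I) (f : I -> T -> K) :
  (forall i, continuous (f i)) -> continuous (fun x => \sum_(i <- s) f i x).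
Proof.
move=> fc; elim: s => [|i s IH] x.
  by under eq_fun do rewrite big_nil; exact: cvg_cst.
by under eq_fun do rewrite big_cons; apply: cvgD; [exact: fc|exact: IH].
Qed.

Section UnitaryBorel.
Variables (R : realType) (N : nat).
Notation UB := (unitary_borel R N).

Lemma continuous_borel (g : unitary_top R N -> R) :
  continuous g -> measurable_fun [set: UB] (g : UB -> R).
Proof.
move=> /continuousP gc; apply: (measurability _ (RGenOpens.measurableE R)).
move=> _ [_ [x [y ->]] <-]; rewrite setTI; apply: sub_sigma_algebra.
by apply: gc; exact: interval_open.
Qed.

Lemma continuous_entry i j :
  continuous (fun U : unitary_top R N => sval U i j : Cplx R).
Proof.
move=> U; apply: (@continuous_comp _ _ _ (fun U : unitary_top R N => sval U)
  (fun M : 'M[Cplx R]_N => M i j)); last exact: coord_continuous.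
exact: initial_continuous.
Qed.

(** In the induced topology it suffices that the product is continuous as a matrix-valued map, and
    its entries are linear in those of [U]. *)
Lemma continuous_umul (V : unitary R N) :
  continuous (umul V : unitary_top R N -> unitary_top R N).
Proof.
apply/continuousP => _ [A oA <-].
have cV : continuous (fun U : unitary_top R N => sval V *m sval U).
  apply: continuous_mx => i j.
  under [X in continuous X]eq_fun do rewrite mxE.
  apply: continuous_sum => k U.
  by apply: continuousM; [exact: cst_continuous|exact: continuous_entry].
by move/continuousP: cV => /(_ A oA).
Qed.

Lemma measurable_umul (V : unitary R N) :
  measurable_fun [set: UB] (umul V : UB -> UB).
Proof.
apply: (@measurability _ _ UB UB setT (umul V) (@open (unitary_top R N))) => //.
move=> _ [A oA <-]; rewrite setTI.
apply: sub_sigma_algebra.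
by have /continuousP := continuous_umul (V := V); apply.
Qed.

Lemma adj_unitary (U : unitary R N) : (sval U)^t* \is unitarymx.
Proof. by rewrite trmxC_unitary; exact: svalP U. Qed.

Definition uadj (U : unitary R N) : unitary R N :=
  exist (fun M : 'M[Cplx R]_N => M \is unitarymx) _ (adj_unitary U).

Lemma unitary_inj (U V : unitary R N) : sval U = sval V -> U = V.
Proof. exact: val_inj. Qed.

Lemma mulmx_adj (U : unitary R N) : sval U *m (sval U)^t* = 1%:M.
Proof. by apply/unitarymxP; exact: svalP U. Qed.

Lemma adj_mulmx (U : unitary R N) : (sval U)^t* *m sval U = 1%:M.
Proof. by apply: mulmx1C; exact: mulmx_adj. Qed.

Lemma uadjK (U V : unitary R N) : umul (uadj U) (umul U V) = V.
Proof. by apply: unitary_inj; rewrite /= mulmxA adj_mulmx mul1mx. Qed.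

Lemma uadjKV (U V : unitary R N) : umul U (umul (uadj U) V) = V.
Proof. by apply: unitary_inj; rewrite /= mulmxA mulmx_adj mul1mx. Qed.

(** Boundedness, unlike integrability, is stable under products, and it gives integrability for
    every probability measure. *)
Definition bounded_borel (f : UB -> Cplx R) : Prop :=
  [/\ measurable_fun [set: UB] (fun U => complex.Re (f U) : R),
      measurable_fun [set: UB] (fun U => complex.Im (f U) : R) &
      exists M : R, forall U, `|f U| <= (M%:C : Cplx R)].

Lemma bounded_borel_cst (c : Cplx R) : bounded_borel (fun _ => c).
Proof.
split; [exact: measurable_cst|exact: measurable_cst|].
by exists (complex.Re `|c|) => _; rewrite normc_def.
Qed.

Lemma bounded_borelD (f g : UB -> Cplx R) : bounded_borel f -> bounded_borel g ->
  bounded_borel (fun U => f U + g U).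
Proof.
move=> [f1 f2 [M Mf]] [g1 g2 [K Kg]]; split.
- apply: eq_measurable_fun (measurable_funD f1 g1) => U _.
  by rewrite [RHS]ReD.
- apply: eq_measurable_fun (measurable_funD f2 g2) => U _.
  by rewrite [RHS]ImD.
- exists (M + K) => U; rewrite rmorphD /=.
  by rewrite (le_trans (ler_normD _ _)) // lerD.
Qed.

Lemma bounded_borelM (f g : UB -> Cplx R) : bounded_borel f -> bounded_borel g ->
  bounded_borel (fun U => f U * g U).
Proof.
move=> [f1 f2 [M Mf]] [g1 g2 [K Kg]]; split.
- apply: eq_measurable_fun
    (measurable_funB (measurable_funM f1 g1) (measurable_funM f2 g2)) => U _.
  by rewrite [RHS]ReM.
- apply: eq_measurable_fun
    (measurable_funD (measurable_funM f1 g2) (measurable_funM f2 g1)) => U _.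
  by rewrite [RHS]ImM.
- by exists (M * K) => U; rewrite rmorphM /= normrM ler_pM.
Qed.

Lemma bounded_borel_conj (f : UB -> Cplx R) :
  bounded_borel f -> bounded_borel (fun U => (f U)^*).
Proof.
move=> [f1 f2 [M Mf]]; split; last by exists M => U; rewrite norm_conjC.
- by apply: eq_measurable_fun f1 => U _; case: (f U).
- rewrite (_ : (fun U => _) = (fun U => - complex.Im (f U))).
    exact: measurable_funN.
  by apply/funext => U; case: (f U).
Qed.

Lemma bounded_borel_sum (I : Type) (s : seq I) (P : pred I)
    (f : I -> UB -> Cplx R) :
  (forall i, bounded_borel (f i)) ->
  bounded_borel (fun U => \sum_(i <- s | P i) f i U).
Proof.
move=> bf; elim: s => [|i s IH].
  by under eq_fun do rewrite big_nil; exact: bounded_borel_cst.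
under eq_fun do rewrite big_cons.
by case: (P i) => //; exact: bounded_borelD.
Qed.

(** Each row of a unitary matrix has squared norm 1, and the other terms of that sum are
    nonnegative. *)
Lemma norm_entry_le1 (U : unitary R N) i j : `|sval U i j| <= 1.
Proof.
have /matrixP/(_ i i) := mulmx_adj U; rewrite !mxE eqxx.
rewrite (bigD1 j) //= !mxE -normCK => E.
rewrite -(@expr_le1 _ 2) // -[X in _ <= X]E lerDl sumr_ge0 // => k _.
by rewrite !mxE -normCK exprn_ge0.
Qed.

Lemma bounded_borel_entry i j : bounded_borel (fun U => sval U i j).
Proof.
split.
- apply: continuous_borel => U.
  exact: continuous_comp (@continuous_entry i j U) (@continuous_Re _ _).
- apply: continuous_borel => U.
  exact: continuous_comp (@continuous_entry i j U) (@continuous_Im _ _).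
- by exists 1 => U; exact: norm_entry_le1.
Qed.

Section Integral.
Variable mu : probability (unitary_borel R N) R.

Lemma bounded_borel_integrable (g : UB -> R) :
  measurable_fun [set: UB] g -> (exists M, forall U, `|g U| <= M) ->
  mu.-integrable setT (EFin \o g).
Proof.
move=> mg [M gM]; apply: measurable_bounded_integrable => //.
  by rewrite (le_lt_trans (probability_le1 mu _)) // ltry.
exists M; split; first exact: num_real.
by move=> K MK U _; rewrite /= (le_trans (gM U)) // ltW.
Qed.

Lemma integrable_Re (f : UB -> Cplx R) : bounded_borel f ->
  mu.-integrable setT (EFin \o (fun U => complex.Re (f U) : R)).
Proof.
case=> f1 _ [M fM]; apply: bounded_borel_integrable => //; exists M => U.
by rewrite -lecR (le_trans (normr_Re_le _)).
Qed.

Lemma integrable_Im (f : UB -> Cplx R) : bounded_borel f ->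
  mu.-integrable setT (EFin \o (fun U => complex.Im (f U) : R)).
Proof.
case=> _ f2 [M fM]; apply: bounded_borel_integrable => //; exists M => U.
by rewrite -lecR (le_trans (normr_Im_le _)).
Qed.

Lemma cintegral_cst (c : Cplx R) : cintegral mu (fun _ => c) = c.
Proof.
rewrite /cintegral !Rintegral_cst // [X in fine X]probability_setT /= !mulr1.
by case: c.
Qed.

Lemma cintegralD (f g : UB -> Cplx R) : bounded_borel f -> bounded_borel g ->
  cintegral mu (fun U => f U + g U) = cintegral mu f + cintegral mu g.
Proof.
move=> bf bg; rewrite /cintegral.
have -> : (fun U => complex.Re (f U + g U)) =
    (fun U => complex.Re (f U) + complex.Re (g U)).
  by apply/funext => U; rewrite ReD.
have -> : (fun U => complex.Im (f U + g U)) =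
    (fun U => complex.Im (f U) + complex.Im (g U)).
  by apply/funext => U; rewrite ImD.
by rewrite !RintegralD //; first [exact: integrable_Re|exact: integrable_Im].
Qed.

Lemma cintegralZ (c : Cplx R) (f : UB -> Cplx R) : bounded_borel f ->
  cintegral mu (fun U => c * f U) = c * cintegral mu f.
Proof.
move=> bf; rewrite /cintegral.
have [iR iI] := (integrable_Re bf, integrable_Im bf).
(* Multiplying [f] by a real constant scales both parts, which gives the integrability of the four
   products in the expansion of [c * f]. *)
have bcf (a : R) : bounded_borel (fun U => (a%:C : Cplx R) * f U).
  exact/bounded_borelM/bf/bounded_borel_cst.
have aR a : mu.-integrable setT (EFin \o (fun U => a * complex.Re (f U) : R)).
  have := integrable_Re (bcf a); congr (mu.-integrable _ _).
  by apply/funext => U /=; rewrite ReM /= mul0r subr0.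
have aI a : mu.-integrable setT (EFin \o (fun U => a * complex.Im (f U) : R)).
  have := integrable_Im (bcf a); congr (mu.-integrable _ _).
  by apply/funext => U /=; rewrite ImM /= mul0r addr0.
have -> : (fun U => complex.Re (c * f U)) = (fun U =>
    complex.Re c * complex.Re (f U) - complex.Im c * complex.Im (f U)).
  by apply/funext => U; rewrite ReM.
have -> : (fun U => complex.Im (c * f U)) = (fun U =>
    complex.Re c * complex.Im (f U) + complex.Im c * complex.Re (f U)).
  by apply/funext => U; rewrite ImM.
rewrite RintegralB // RintegralD // !RintegralZl //.
by case: c.
Qed.

Lemma cintegral_sum (I : Type) (s : seq I) (P : pred I)
    (f : I -> UB -> Cplx R) : (forall i, bounded_borel (f i)) ->
  cintegral mu (fun U => \sum_(i <- s | P i) f i U)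
  = \sum_(i <- s | P i) cintegral mu (f i).
Proof.
move=> bf; elim: s => [|i s IH].
  rewrite big_nil -[RHS](cintegral_cst 0); congr cintegral.
  by apply/funext => U; rewrite big_nil.
transitivity (cintegral mu (fun U => if P i then f i U +
    \sum_(j <- s | P j) f j U else \sum_(j <- s | P j) f j U)).
  by congr cintegral; apply/funext => U; rewrite big_cons.
rewrite big_cons; case: (P i) => //; rewrite cintegralD ?IH //.
exact: bounded_borel_sum.
Qed.

Hypothesis mu_haar : haar_measure mu.

Lemma Rintegral_umul (V : unitary R N) (g : UB -> R) :
  measurable_fun [set: UB] g -> (exists M, forall U, `|g U| <= M) ->
  (\int[mu]_(U in [set: UB]) g (umul V U) = \int[mu]_(U in [set: UB]) g U)%R.
Proof.
move=> mg [M gM]; rewrite /Rintegral; congr fine.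
have ig : mu.-integrable (umul V @^-1` setT) ((EFin \o g) \o umul V).
  rewrite preimage_setT; apply: (@bounded_borel_integrable (g \o umul V)).
    exact: measurableT_comp mg (measurable_umul V).
  by exists M => U; exact: gM.
have mEg : measurable_fun [set: UB] (EFin \o g) by exact/measurable_EFinP.
have := integral_pushforward (measurable_umul V) mEg ig measurableT.
rewrite preimage_setT => <-.
apply: eq_measure_integral => [|mV A mA _]; first exact: measurable_umul.
(* The preimage of [A] under multiplication by [V] is its image under multiplication by the adjoint
   of [V], to which Haar invariance applies. *)
transitivity (mu [set umul (uadj V) U | U in A]); last exact: mu_haar.
congr (mu _); apply/seteqP; split => [U AU|_ [U AU <-]] /=.
  by exists (umul V U) => //; rewrite uadjK.
by rewrite uadjKV.
Qed.

Lemma cintegral_umul (V : unitary R N) (f : UB -> Cplx R) : bounded_borel f ->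
  cintegral mu (fun U => f (umul V U)) = cintegral mu f.
Proof.
case=> f1 f2 [M fM]; rewrite /cintegral.
rewrite (@Rintegral_umul V (fun U => complex.Re (f U))) //; last first.
  by exists M => U; rewrite -lecR (le_trans (normr_Re_le _)).
rewrite (@Rintegral_umul V (fun U => complex.Im (f U))) //.
by exists M => U; rewrite -lecR (le_trans (normr_Im_le _)).
Qed.

End Integral.
End UnitaryBorel.

(** * The Clifford group *)

Section Clifford.
Variables (R : realType) (d n : nat).
Hypotheses (d_prime : prime d) (d_gt2 : (2 < d)%N).

Notation N := (qdim d n).
Notation chi := (@chi R d).
Notation Q := (qbasis d n).
Notation weyl := (@weyl R d n).
Notation transvection := (@transvection R d n).

Definition qunit (j : 'I_n) : Q := [ffun k => (k == j)%:R].

Lemma on_qudit_X j : on_qudit j (pauliX R d) = weyl (qunit j, 0).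
Proof.
apply/matrixP => r c; rewrite !mxE /= qdot0r mulr0 add0r qdotC qdot0r chi0.
rewrite -mulrnA mulnb; congr (_%:R).
congr nat_of_bool; apply: (sameP andP).
apply: (iffP eqP) => [rc|[/eqP rj /forallP rk]].
  split; first by rewrite rc !ffunE eqxx.
  by apply/forallP => k; apply/implyP => kj; rewrite rc !ffunE (negbTE kj) addr0.
apply/ffunP => k; rewrite !ffunE; case: (eqVneq k j) => [->|kj].
  by rewrite rj.
by rewrite addr0; apply/eqP; have := rk k; rewrite kj.
Qed.

Lemma on_qudit_Z j : on_qudit j (pauliZ R d) = weyl (0, qunit j).
Proof.
apply/matrixP => r c; rewrite !mxE /= qdotC qdot0r mulr0 add0r.
have -> : qdot (qunit j) (qket c) = qket c j.
  rewrite /qdot (bigD1 j) //= big1 => [|k kj].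
    by rewrite !ffunE eqxx mul1r addr0.
  by rewrite !ffunE (negbTE kj) mul0r.
rewrite -mulrnA mulnb addr0; congr (_ *+ _).
congr nat_of_bool; apply: (sameP andP).
apply: (iffP eqP) => [rc|[/eqP rj /forallP rk]].
  by split; [rewrite rc|apply/forallP => k; rewrite rc eqxx implybT].
apply/ffunP => k; case: (eqVneq k j) => [->|kj]; first by rewrite rj.
by apply/eqP; have := rk k; rewrite kj.
Qed.

Lemma weylX u k : weyl u ^+ k = weyl (u *+ k).
Proof.
elim: k => [|k IH]; first by rewrite expr0 mulr0n weyl0.
rewrite exprS IH mulrS [LHS](weylM R d_prime d_gt2) sympMnr sympxx !mulr0 chi0.
by rewrite scale1r.
Qed.

(** Every factor is a Weyl operator, and in a product the labels add while phases stay values of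
    [chi]. Only the label is tracked; the phase is left existential. *)
Lemma pauli_prodE (a b : {ffun 'I_n -> 'Z_d}) : exists z,
  \prod_(j < n) (on_qudit j (pauliX R d) ^+ a j * on_qudit j (pauliZ R d) ^+ b j)
  = chi z *: weyl (a, b).
Proof.
pose v j : Q * Q := (qunit j, 0) *+ a j + (0, qunit j) *+ b j.
have fstn (u : Q * Q) k : (u *+ k).1 = u.1 *+ k.
  by elim: k => // k IH; rewrite !mulrS -IH.
have sndn (u : Q * Q) k : (u *+ k).2 = u.2 *+ k.
  by elim: k => // k IH; rewrite !mulrS -IH.
have -> : (a, b) = \sum_(j < n) v j.
  have fsts (s : seq 'I_n) : (\sum_(j <- s) v j).1 = \sum_(j <- s) (v j).1.
    by elim: s => [|j s IH]; rewrite ?big_nil // !big_cons -IH.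
  have snds (s : seq 'I_n) : (\sum_(j <- s) v j).2 = \sum_(j <- s) (v j).2.
    by elim: s => [|j s IH]; rewrite ?big_nil // !big_cons -IH.
  apply/eqP; rewrite -pair_eqE /= fsts snds; apply/andP; split; apply/eqP/ffunP => k.
    rewrite sum_ffunE (bigD1 k) //= big1 => [|j jk].
      by rewrite ffunE !fstn /= !ffunMnE !ffunE eqxx mul0rn !addr0 natr_Zp.
    rewrite ffunE !fstn /= !ffunMnE !ffunE eq_sym (negbTE jk).
    by rewrite !mul0rn addr0.
  rewrite sum_ffunE (bigD1 k) //= big1 => [|j jk].
    by rewrite ffunE !sndn /= !ffunMnE !ffunE eqxx mul0rn !addr0 add0r natr_Zp.
  rewrite ffunE !sndn /= !ffunMnE !ffunE eq_sym (negbTE jk).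
  by rewrite !mul0rn addr0.
elim/big_rec2: _ => [|j P u _ [z ->]].
  by exists 0; rewrite chi0 scale1r weyl0.
rewrite on_qudit_X on_qudit_Z !weylX.
have W v1 v2 : weyl v1 * weyl v2 = chi (half d * symp v1 v2) *: weyl (v1 + v2).
  exact: weylM.
rewrite W -[_ * _]/(_ *m _) -scalemxAl -scalemxAr weylM // !scalerA -!chiD //.
by eexists.
Qed.

Lemma pauli_groupE : pauli_group R d n =
  [set P | exists (z : 'Z_d) (u : Q * Q), P = chi z *: weyl u].
Proof.
apply/seteqP; split => [P [eta [a [b ->]]]|P [z [[a b] ->]]] /=.
  have [z ->] := pauli_prodE a b.
  by exists (eta + z), (a, b); rewrite scalerA chiD.
have [z0 E] := pauli_prodE a b; exists (z - z0), a, b.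
by rewrite E scalerA -/(chi _) -chiD // subrK.
Qed.

(** The two clauses are the two inclusions of the set equality; phases are central, so testing Weyl
    operators is enough. *)
Lemma cliffordP (V : unitary R N) : clifford R d n V <->
  (forall u, exists z v, sval V *m weyl u *m (sval V)^t* = chi z *: weyl v) /\
  (forall u, exists z v, (sval V)^t* *m weyl u *m sval V = chi z *: weyl v).
Proof.
rewrite /clifford /= pauli_groupE; split.
  move=> E; split => u.
    have : [set P | exists z v, P = chi z *: weyl v]
        (sval V *m weyl u *m (sval V)^t*).
      by rewrite -E; exists (weyl u) => //; exists 0, u; rewrite chi0 scale1r.
    by [].
  have : [set P | exists z v, P = chi z *: weyl v] (weyl u).
    by exists 0, u; rewrite chi0 scale1r.
  rewrite -E => -[_ [z [v ->]] <-]; exists z, v.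
  by rewrite !mulmxA adj_mulmx mul1mx -mulmxA adj_mulmx mulmx1.
case=> VW WV; apply/seteqP; split => P.
  move=> [_ [z [u ->]] <-]; have [y [v E]] := VW u; exists (z + y), v.
  by rewrite -scalemxAr -scalemxAl E scalerA chiD.
move=> [z [u ->]]; have [y [v E]] := WV u.
exists (chi z *: ((sval V)^t* *m weyl u *m sval V)).
  by exists (z + y), v; rewrite E scalerA chiD.
rewrite -scalemxAr -scalemxAl !mulmxA mulmx_adj mul1mx -mulmxA mulmx_adj.
by rewrite mulmx1.
Qed.

Definition weyl_unitary_elt u : unitary R N :=
  exist (fun M : 'M[Cplx R]_N => M \is unitarymx) _ (weyl_unitary R d_prime d_gt2 u).

Definition transvection_elt s u : unitary R N :=
  exist (fun M : 'M[Cplx R]_N => M \is unitarymx) _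
    (transvection_unitary R d_prime d_gt2 s u).

Lemma weyl_conj u v : weyl u *m weyl v *m (weyl u)^t* = chi (symp u v) *: weyl v.
Proof.
by rewrite weyl_adj // weyl_comm // -scalemxAl -mulmxA weylV // mulmx1.
Qed.

Lemma clifford_weyl u : clifford R d n (weyl_unitary_elt u).
Proof.
apply/cliffordP; split => v /=; first by exists (symp u v), v; rewrite weyl_conj.
exists (symp (- u) v), v.
by rewrite -weyl_conj (weyl_adj R d_prime d_gt2 u) weyl_adj // opprK.
Qed.

Lemma clifford_transvection s u : clifford R d n (transvection_elt s u).
Proof.
have H s' v : exists z w,
    transvection s' u *m weyl v *m (transvection s' u)^t* = chi z *: weyl w.
  by rewrite transvection_weyl // weylM // scalerA -chiD //; do 2 eexists.
apply/cliffordP; split => v /=; first exact: H.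
have [z [w E]] := H (- s) v; exists z, w; rewrite -E.
by rewrite !transvection_adj // opprK.
Qed.

(** The transvection along [v - u] adds to [u] the multiple [2 * s * t] of [v - u]. As [t] equals
    [symp v u], it is invertible, and [s = 1 / (2 t)] makes the result [v]. *)
Lemma transvection_orbit u v : symp u v != 0 -> exists s z,
  transvection s (v - u) *m weyl u *m (transvection s (v - u))^t*
  = chi z *: weyl v.
Proof.
move=> uv0; pose t := symp (v - u) u.
have t0 : t != 0.
  by rewrite /t sympDl symp_antisym symp_antisym (symp_antisym u (- u)) sympNr
     sympxx oppr0 oppr0 addr0 opprK symp_antisym oppr_eq0.
have ut := Zd_unit d_prime t0; pose s : 'Z_d := (2 * t)^-1.
exists s, (s * t ^+ 2 + half d * symp u (v - u)).
rewrite transvection_weyl // -/t (_ : 2 * s * t = 1); last first.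
  by rewrite mulrAC divrr // unitrM two_unit // ut.
by rewrite zscale1 weylM // scalerA -chiD // (addrC u) subrK.
Qed.

Lemma clifford_umul V U : clifford R d n V -> clifford R d n U ->
  clifford R d n (umul V U).
Proof.
move=> cV cU; rewrite /clifford /= -{2}cV -{2}cU image_comp; congr (_ @` _).
by apply/funext => P /=; rewrite trmx_mul map_mxM !mulmxA.
Qed.

Lemma clifford_uadj V : clifford R d n V -> clifford R d n (uadj V).
Proof.
move=> cV; rewrite /clifford /= -{1}cV image_comp -[RHS]image_id.
congr (_ @` _); apply/funext => P /=; rewrite trmxCK.
by rewrite !mulmxA adj_mulmx mul1mx -mulmxA adj_mulmx mulmx1.
Qed.
End Clifford.

(** * Twirling *)

Section ConjBy.
Variables (R : realType) (N : nat).
Notation UB := (unitary_borel R N).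

Definition conj_by (U : unitary R N) (A : 'M[Cplx R]_N) : 'M[Cplx R]_N :=
  sval U *m A *m (sval U)^t*.

Lemma conj_by_entry U A i k : conj_by U A i k =
  \sum_(p : 'I_N * 'I_N) (sval U i p.1 * (sval U k p.2)^*) * A p.1 p.2.
Proof.
rewrite !mxE -(pair_bigA _ (fun j l => sval U i j * (sval U k l)^* * A j l)) /=.
rewrite exchange_big; apply: eq_bigr => l _ /=; rewrite !mxE mulr_suml.
by apply: eq_bigr => j _; rewrite mulrAC.
Qed.

Lemma conj_by_umul V U A : conj_by (umul V U) A = conj_by V (conj_by U A).
Proof. by rewrite /conj_by /= trmx_mul map_mxM !mulmxA. Qed.

Lemma conj_byM U A B : conj_by U A *m conj_by U B = conj_by U (A *m B).
Proof.
by rewrite /conj_by !mulmxA -(mulmxA _ _ (sval U)) adj_mulmx mulmx1.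
Qed.

Lemma conj_by1 U : conj_by U 1%:M = 1%:M.
Proof. by rewrite /conj_by mulmx1 mulmx_adj. Qed.

Lemma tr_conj_by U A : \tr (conj_by U A) = \tr A.
Proof. by rewrite mxtrace_mulC mulmxA adj_mulmx mul1mx. Qed.

Lemma conj_byZ U c A : conj_by U (c *: A) = c *: conj_by U A.
Proof. by rewrite /conj_by -scalemxAr -scalemxAl. Qed.

Lemma bounded_borel_conj_by A i k : bounded_borel (fun U : UB => conj_by U A i k).
Proof.
rewrite (_ : (fun U => _) = fun U : UB =>
  \sum_(p : 'I_N * 'I_N) (sval U i p.1 * (sval U k p.2)^*) * A p.1 p.2).
  apply: bounded_borel_sum => p; apply: bounded_borelM.
    apply: bounded_borelM; first exact: bounded_borel_entry.
    exact/bounded_borel_conj/bounded_borel_entry.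
  exact: bounded_borel_cst.
by apply/funext => U; exact: conj_by_entry.
Qed.

(** Averages over phase classes use arbitrary representatives, so their invariance can only be
    expected for such functions. *)
Definition phase_invariant (f : UB -> Cplx R) :=
  forall U V : unitary R N, phase_class U V -> f U = f V.

Lemma phase_conj_by U V A : phase_class U V -> conj_by U A = conj_by V A.
Proof.
move=> [c c1 E]; rewrite /conj_by E linearZ /= map_mxZ -!scalemxAl -scalemxAr.
by rewrite scalerA -normCK c1 expr1n scale1r.
Qed.
End ConjBy.

Section Twirl.
Variables (R : realType) (d n : nat).
Hypotheses (d_prime : prime d) (d_gt2 : (2 < d)%N) (n_ge1 : (1 <= n)%N).

Notation N := (qdim d n).
Notation chi := (@chi R d).
Notation Q := (qbasis d n).
Notation weyl := (@weyl R d n).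
Notation UB := (unitary_borel R N).

(** The difference of the two averages enters only through linearity, vanishing on constants, and
    Clifford invariance. *)
Variable D : (UB -> Cplx R) -> Cplx R.
Hypothesis D_sum : forall (I : finType) (c : I -> Cplx R) (f : I -> UB -> Cplx R),
  (forall i, bounded_borel (f i)) ->
  D (fun U => \sum_i c i * f i U) = \sum_i c i * D (f i).
Hypothesis D_one : D (fun _ => 1) = 0.
Hypothesis D_clifford : forall V f, clifford R d n V ->
  bounded_borel f -> phase_invariant f -> D (fun U => f (umul V U)) = D f.

Variables A B : 'M[Cplx R]_N.

(** Contracting the second tensor factor with [M] turns a second moment into a linear map on
    matrices; taking [M] to be a matrix unit recovers the individual entries. *)
Definition twirl (M : 'M[Cplx R]_N) : 'M[Cplx R]_N :=
  \matrix_(i, k) D (fun U => conj_by U A i k * \tr (conj_by U B *m M)).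

Lemma D_cst c : D (fun _ => c) = 0.
Proof.
have := @D_sum unit (fun=> c) (fun=> (fun _ => 1)) (fun=> bounded_borel_cst N 1).
rewrite [RHS]big1 => [<-|_ _]; last by rewrite D_one mulr0.
by congr D; apply/funext => U; rewrite big_const card_unit /= addr0 mulr1.
Qed.

Lemma bounded_borel_tr M : bounded_borel (fun U : UB => \tr (conj_by U B *m M)).
Proof.
apply: bounded_borel_sum => i; rewrite (_ : (fun U => _) = fun U : UB =>
  \sum_j conj_by U B i j * M j i).
  apply: bounded_borel_sum => j.
  apply: bounded_borelM; last exact: bounded_borel_cst.
  exact: bounded_borel_conj_by.
by apply/funext => U; rewrite mxE.
Qed.

Lemma bounded_borel_twirl M i k :
  bounded_borel (fun U : UB => conj_by U A i k * \tr (conj_by U B *m M)).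
Proof.
by apply: bounded_borelM; [exact: bounded_borel_conj_by|exact: bounded_borel_tr].
Qed.

Lemma twirl_sum (I : finType) (c : I -> Cplx R) (M : I -> 'M[Cplx R]_N) :
  twirl (\sum_i c i *: M i) = \sum_i c i *: twirl (M i).
Proof.
apply/matrixP => i k; rewrite summxE !mxE.
under [RHS]eq_bigr do rewrite !mxE.
rewrite -D_sum; last by move=> x; exact: bounded_borel_twirl.
congr D; apply/funext => U; rewrite mulmx_sumr raddf_sum mulr_sumr.
apply: eq_bigr => x _; rewrite -scalemxAr /= mxtraceZ; ring.
Qed.

Lemma twirlZ c M : twirl (c *: M) = c *: twirl M.
Proof.
have := @twirl_sum unit (fun=> c) (fun=> M).
by rewrite !big_const card_unit /= !addr0.
Qed.

(** Conjugation by [V] passes inside [D] by linearity, and the trace is unchanged when both its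
    factors are conjugated. The integrand becomes the one for the conjugated [M] evaluated at
    [umul V U], and invariance of [D] removes [V]. *)
Lemma twirl_covariant V M : clifford R d n V ->
  conj_by V (twirl M) = twirl (conj_by V M).
Proof.
move=> cV; apply/matrixP => i k; rewrite conj_by_entry [RHS]mxE.
under eq_bigr do rewrite mxE.
rewrite -D_sum; last by move=> x; exact: bounded_borel_twirl.
rewrite -[RHS](D_clifford cV); last 2 first.
- exact: bounded_borel_twirl.
- by move=> U W UW; rewrite !(phase_conj_by _ UW).
congr D; apply/funext => U; rewrite !conj_by_umul conj_byM tr_conj_by.
rewrite [X in _ = X * _]conj_by_entry mulr_suml.
by apply: eq_bigr => p _; rewrite mulrA.
Qed.

(** By covariance [twirl (weyl u)] has the same commutation phases with Weyl operators as [weyl u],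
    so its product with [weyl (- u)] commutes with all of them and is scalar. *)
Lemma twirl_weyl u : exists c, twirl (weyl u) = c *: weyl u.
Proof.
have cov x : weyl x *m twirl (weyl u) = chi (symp x u) *: (twirl (weyl u) *m weyl x).
  have := twirl_covariant (weyl u) (clifford_weyl R d_prime d_gt2 x).
  rewrite {2}/conj_by /= weyl_conj // twirlZ => E.
  rewrite scalemxAl -E /conj_by /= -mulmxA (weyl_adj R d_prime d_gt2).
  by rewrite -[X in _ *m (_ *m weyl X)]opprK weylV // mulmx1.
have [|c cE] := @weyl_centralizer R d n d_prime d_gt2 (twirl (weyl u) *m weyl (- u)).
  move=> x; rewrite mulmxA cov -scalemxAl -mulmxA (weyl_comm R d_prime d_gt2 x).
  rewrite -scalemxAr scalerA -chiD // sympNr subrr chi0 scale1r.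
  by rewrite mulmxA.
exists c; rewrite -[LHS]mulmx1 -(weylV R d_prime d_gt2 (- u)) opprK mulmxA cE.
by rewrite mul_scalar_mx.
Qed.

(** A transvection takes [weyl x] to a phase times [weyl y] when [symp x y] is nonzero; in the
    covariance identity this phase cancels, so the eigenvalue is carried from [x] to [y]. *)
Lemma twirl_weyl_eq u v c : u != 0 -> v != 0 ->
  twirl (weyl u) = c *: weyl u -> twirl (weyl v) = c *: weyl v.
Proof.
move=> u0 v0.
pose P u v := forall c, twirl (weyl u) = c *: weyl u -> twirl (weyl v) = c *: weyl v.
suff : P u v by apply.
apply: (symp_connect (P := P)) => // [x y z xy yz b /xy/yz //|x y xy b xb].
have [s [z E]] := transvection_orbit R d_prime d_gt2 xy.
have := twirl_covariant (weyl x) (clifford_transvection R d_prime d_gt2 s (y - x)).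
rewrite xb conj_byZ {1 2}/conj_by /= E twirlZ => /(congr1 (fun M => chi (- z) *: M)).
by rewrite !scalerA mulrAC -chiD // addNr chi0 mul1r !scale1r.
Qed.

Lemma qdim_gt1 : (1 < N)%N.
Proof.
have d1 := prime_gt1 d_prime; apply: leq_trans d1 _.
by rewrite qdimE ?prime_gt1 // -{1}(expn1 d) leq_pexp2l // prime_gt0.
Qed.

(** The identity occurs in the Weyl expansion of a matrix unit only when [r = s], with coefficient
    1/N; the last term corrects its eigenvalue from [c] to [c0]. *)
Lemma twirl_delta c c0 r s :
  (forall v, v != 0 -> twirl (weyl v) = c *: weyl v) ->
  twirl 1%:M = c0 *: 1%:M ->
  twirl (delta_mx r s) =
    c *: delta_mx r s + (N%:R^-1 * (c0 - c)) *: 1%:M *+ (r == s).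
Proof.
move=> cE c0E; rewrite (delta_weyl R d_prime d_gt2 r s) twirlZ twirl_sum.
rewrite (scalerA c) (mulrC c) -!scalerA scalerMnr.
rewrite -scalerDr; congr (_ *: _).
rewrite scaler_sumr (bigD1 (0 : Q)) //= [X in _ = X + _](bigD1 (0 : Q)) //=.
rewrite addrAC; congr (_ + _); last first.
  apply: eq_bigr => b b0; rewrite cE ?scalerA 1?mulrC //.
  by rewrite -pair_eqE /= negb_and b0 orbT.
rewrite qdot0r [qdot 0 _]qdotC qdot0r mulr0 addr0 oppr0 chi0 !scale1r.
have [->|rs] := eqVneq r s.
  by rewrite subrr weyl0 c0E -scalerDl addrC subrK.
rewrite mulr0n addr0 cE // -pair_eqE /= negb_and subr_eq0.
by rewrite (inj_eq (@qket_inj d n)) rs.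
Qed.

(** The trace of the integrand is the constant [\tr A * \tr B]. *)
Lemma tr_twirl1 : \tr (twirl 1%:M) = 0.
Proof.
rewrite /mxtrace (eq_bigr (fun i => 1 * D (fun U =>
  conj_by U A i i * \tr (conj_by U B *m 1%:M)))); last first.
  by move=> i _; rewrite mxE mul1r.
rewrite -(D_sum (fun=> 1)); last by move=> i; exact: bounded_borel_twirl.
transitivity (D (fun=> \tr A * \tr B)); last exact: D_cst.
congr D; apply/funext => U.
under eq_bigr do rewrite mul1r mulmx1 tr_conj_by.
by rewrite -mulr_suml -[X in _ = X * _](tr_conj_by U).
Qed.

Lemma tr_mul_delta (M : 'M[Cplx R]_N) b a : \tr (M *m delta_mx b a) = M a b.
Proof.
rewrite /mxtrace (bigD1 a) //= big1 ?addr0 => [|x xa].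
  rewrite mxE (bigD1 b) //= big1 ?addr0 => [|x xb].
    by rewrite mxE !eqxx mulr1.
  by rewrite mxE (negbTE xb) mulr0.
by rewrite mxE big1 // => j _; rewrite mxE (negbTE xa) andbF mulr0.
Qed.

(** This sum pairs the second moment with the swap operator, and its integrand is the constant
    [\tr (A *m B)]. *)
Lemma twirl_swap_trace :
  \sum_(p : 'I_N * 'I_N) twirl (delta_mx p.1 p.2) p.1 p.2 = 0.
Proof.
rewrite (eq_bigr (fun p => 1 * D (fun U =>
  conj_by U A p.1 p.2 * \tr (conj_by U B *m delta_mx p.1 p.2)))); last first.
  by move=> i _; rewrite mxE mul1r.
rewrite -(D_sum (fun=> 1)); last by move=> i; exact: bounded_borel_twirl.
transitivity (D (fun=> \tr (A *m B))); last exact: D_cst.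
congr D; apply/funext => U.
rewrite -(tr_conj_by U) -conj_byM [in RHS]/mxtrace.
under [RHS]eq_bigr do rewrite mxE.
rewrite pair_bigA; apply: eq_bigr => -[i a] _ /=.
by rewrite mul1r tr_mul_delta.
Qed.

Lemma twirl_eq0 r s : twirl (delta_mx r s) = 0.
Proof.
have N0 : (N%:R : Cplx R) != 0 by rewrite pnatr_eq0 -lt0n qdim_gt0.
(* With at least one qudit there is a nonzero label, whose eigenvalue serves as [c]. *)
pose u0 : Q * Q := (qunit d (Ordinal n_ge1), 0).
have u00 : u0 != 0.
  rewrite -pair_eqE negb_and /=; apply/orP; left; apply/eqP => /ffunP.
  move=> /(_ (Ordinal n_ge1)); rewrite !ffunE eqxx => /eqP.
  by rewrite oner_eq0.
have [c cu0] := twirl_weyl u0.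
have cE v : v != 0 -> twirl (weyl v) = c *: weyl v.
  by move=> v0; exact: twirl_weyl_eq cu0.
have [c0 c0E] := twirl_weyl 0; rewrite weyl0 in c0E.
have c00 : c0 = 0.
  have /eqP := tr_twirl1; rewrite c0E linearZ /= mxtrace1 mulf_eq0 (negbTE N0).
  by rewrite orbF => /eqP.
have dE := twirl_delta _ _ cE c0E.
suff c_eq0 : c = 0.
  by rewrite dE c00 c_eq0 subrr mulr0 !scale0r mul0rn addr0.
have := twirl_swap_trace.
(* With [c0 = 0] the sum equals c (N^2 - 1), which forces [c = 0] because N > 1. *)
rewrite (eq_bigr (fun p => c + (N%:R^-1 * - c) *+ (p.1 == p.2))); last first.
  move=> [i a] _ /=; rewrite dE c00 sub0r; case: eqVneq => [->|_].
    by rewrite !mulr1n !mxE !eqxx !mulr1.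
  by rewrite !mulr0n addr0 !mxE !eqxx mulr1 addr0.
rewrite big_split /= sumr_const card_prod card_ord.
rewrite -(pair_bigA _ (fun i a => (N%:R^-1 * - c) *+ (i == a))) /=.
under [X in _ + X]eq_bigr => i _.
  rewrite (bigD1 i) //= eqxx big1 ?addr0 => [|a ai]; last first.
    by rewrite eq_sym (negbTE ai).
  over.
rewrite sumr_const card_ord mulr1n -mulrnAl.
rewrite -[_ *+ N in X in _ + X]mulr_natr mulVf //.
rewrite mul1r -mulr_natr -[X in _ - X]mulr1 -mulrBr => /eqP.
rewrite mulf_eq0 subr_eq0 -[1]/(1%:R) eqr_nat muln_eq1 => /orP[/eqP //|].
by move=> /andP[/eqP N1 _]; have := qdim_gt1; rewrite [X in (_ < X)%N]N1.
Qed.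

Lemma D_conj_by_eq0 i k a b :
  D (fun U => conj_by U A i k * conj_by U B a b) = 0.
Proof.
have /matrixP/(_ i k) := twirl_eq0 b a; rewrite !mxE => E.
by rewrite -[RHS]E; congr D; apply/funext => U; rewrite tr_mul_delta.
Qed.
End Twirl.

(** * Averages over the Clifford group *)

Section PhaseClass.
Variables (R : realType) (N : nat).
Implicit Types (U V W : unitary R N).

Lemma phase_class_umul V U W :
  phase_class U W -> phase_class (umul V U) (umul V W).
Proof. by move=> [c c1 E]; exists c; rewrite //= E -scalemxAr. Qed.

Lemma image_phase_class V U :
  [set umul V W | W in phase_class U] = phase_class (umul V U).
Proof.
apply/seteqP; split=> [_ [W UW <-]|W UW]; first exact: phase_class_umul.
exists (umul (uadj V) W); last exact: uadjKV.
by rewrite -[U](uadjK V); exact: phase_class_umul.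
Qed.
End PhaseClass.

Section CliffordGroup.
Variables (R : realType) (d n : nat).
Hypotheses (d_prime : prime d) (d_gt2 : (2 < d)%N).

Notation N := (qdim d n).
Notation chi := (@chi R d).
Notation Q := (qbasis d n).
Notation weyl := (@weyl R d n).
Notation UB := (unitary_borel R N).
Notation G := (clifford_group R d n).

(** The adjoint of [U] times [V] commutes with all Weyl operators, hence is a scalar, of modulus 1
    by unitarity. *)
Lemma conj_by_weyl_phase (U V : unitary R N) :
  (forall u, conj_by V (weyl u) = conj_by U (weyl u)) -> phase_class U V.
Proof.
move=> UV.
have [|c cE] := weyl_centralizer d_prime d_gt2 (Y := (sval U)^t* *m sval V).
  move=> u; have := congr1 (fun M => (sval U)^t* *m M *m sval V) (UV u).
  rewrite /conj_by !mulmxA adj_mulmx mul1mx -!mulmxA adj_mulmx mulmx1 !mulmxA.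
  by move=> ->; rewrite ?mulmxA.
have VE : sval V = c *: sval U.
  by rewrite -[LHS]mul1mx -(mulmx_adj U) -mulmxA cE mul_mx_scalar.
exists c => //; have := mulmx_adj V.
rewrite VE linearZ /= map_mxZ -scalemxAl -scalemxAr mulmx_adj scalerA -normCK.
pose r0 : 'I_N := Ordinal (qdim_gt0 d n).
move=> /matrixP/(_ r0 r0); rewrite !mxE eqxx mulr1 => /eqP.
by rewrite pexpr_eq1 // => /eqP.
Qed.

(** A class is determined by how it permutes the Weyl operators up to phase, and such data [phi]
    form a finite type. *)
Lemma finite_clifford_group : finite_set G.
Proof.
pose F := {ffun Q * Q -> 'Z_d * (Q * Q)}.
pose g (phi : F) : set (unitary R N) :=
  [set V | forall u, conj_by V (weyl u) = chi (phi u).1 *: weyl (phi u).2].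
apply: (@sub_finite_set _ _ (g @` [set: F])); last first.
  by apply: finite_image; exact: finite_finset.
move=> _ [U cU <-]; have [Uw _] := (cliffordP d_prime d_gt2 U).1 cU.
have /choice[f fP] : forall u, exists p : 'Z_d * (Q * Q),
    conj_by U (weyl u) = chi p.1 *: weyl p.2.
  by move=> u; have [z [v E]] := Uw u; exists (z, v).
exists [ffun u => f u] => //; apply/seteqP; split=> V.
  move=> VP; apply: conj_by_weyl_phase => u.
  by rewrite (VP u) ffunE fP.
by move=> UV u; rewrite -(phase_conj_by _ UV) ffunE fP.
Qed.

Lemma clifford_phase_class K :
  G K -> exists2 U, clifford R d n U & K = phase_class U.
Proof. by case=> U cU <-; exists U. Qed.

Definition group_average (rep : set (unitary R N) -> unitary R N)
    (f : UB -> Cplx R) : Cplx R :=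
  #|` fset_set G|%:R^-1 * (\sum_(K \in G) f (rep K)).

Variable rep : set (unitary R N) -> unitary R N.
Hypothesis repP : forall K, G K -> K (rep K).

Lemma group_averageE f : group_average rep f =
  #|` fset_set G|%:R^-1 * \sum_(K <- fset_set G) f (rep K).
Proof. congr (_ * _); exact: fsbig_finite finite_clifford_group. Qed.

Lemma group_average_sum (I : finType) (c : I -> Cplx R) (f : I -> UB -> Cplx R) :
  group_average rep (fun U => \sum_i c i * f i U) =
  \sum_i c i * group_average rep (f i).
Proof.
rewrite group_averageE exchange_big mulr_sumr.
by apply: eq_bigr => i _; rewrite group_averageE -mulr_sumr mulrCA.
Qed.

Lemma group_average_one : group_average rep (fun _ => 1) = 1.
Proof.
rewrite group_averageE big_const_seq count_predT iter_addr_0 mulVf //.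
(* The group is nonempty: it contains the class of the identity, written [weyl 0]. *)
rewrite pnatr_eq0 -lt0n cardfs_gt0; apply/fset0Pn.
exists (phase_class (weyl_unitary_elt R d_prime d_gt2 0)).
rewrite in_fset_set; last exact: finite_clifford_group.
apply/mem_set; exists (weyl_unitary_elt R d_prime d_gt2 0) => //.
exact: clifford_weyl.
Qed.

(** Left multiplication by [V] permutes the classes. The representative of [h K] and [V] times that
    of [K] may differ, but only by a phase that [f] does not see. *)
Lemma group_average_umul V f : clifford R d n V -> phase_invariant f ->
  group_average rep (fun U => f (umul V U)) = group_average rep f.
Proof.
move=> cV fP; rewrite /group_average; congr (_ * _).
pose h (K : set (unitary R N)) := [set umul V U | U in K].
rewrite [RHS](reindex_fsbig h G G); last first.
  split.
  - move=> K /clifford_phase_class[U cU ->]; rewrite /h image_phase_class.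
    by exists (umul V U) => //; exact: clifford_umul.
  - have hsub K K' : h K = h K' -> K `<=` K'.
      move=> E U KU; have [W K'W] : h K' (umul V U) by rewrite -E; exists U.
      by move=> /(congr1 (umul (uadj V))); rewrite !uadjK => <-.
    by move=> K K' _ _ E; apply/seteqP; split; exact: hsub.
  - move=> K /clifford_phase_class[U cU ->].
    exists (phase_class (umul (uadj V) U)).
      exists (umul (uadj V) U) => //; apply: clifford_umul => //.
      exact: clifford_uadj.
    by rewrite /h image_phase_class uadjKV.
apply: eq_fsbigr => K /set_mem GK.
have [U cU KE] := clifford_phase_class GK.
have hK : h K = phase_class (umul V U) by rewrite KE /h image_phase_class.
have GhK : G (h K) by rewrite hK; exists (umul V U) => //; exact: clifford_umul.
have := repP GhK; have := repP GK; rewrite {1}KE {1}hK => UK VK.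
by rewrite -(fP _ _ VK); apply/esym/fP; exact: phase_class_umul.
Qed.
End CliffordGroup.

(** * Balanced monomials *)

Section Monomials.
Variables (R : realType) (N : nat).
Notation UB := (unitary_borel R N).

(** Listing the variables with multiplicity makes the degree a length, so that low degrees can be
    treated by cases on lists. *)
Lemma prod_expn_seq (I : Type) (r : seq I) (m : I -> nat) :
  exists s : seq I, size s = (\sum_(i <- r) m i)%N /\
    forall v : I -> Cplx R, \prod_(i <- r) v i ^+ m i = \prod_(i <- s) v i.
Proof.
elim: r => [|i r [s [ss vs]]].
  by exists [::]; rewrite big_nil; split => // v; rewrite !big_nil.
exists (nseq (m i) i ++ s); split; first by rewrite size_cat size_nseq big_cons ss.
by move=> v; rewrite big_cons big_cat big_nseq iter_mulr_1 vs.
Qed.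

Lemma conj_by_delta (U : unitary R N) i j k l :
  conj_by U (delta_mx j l) i k = sval U i j * (sval U k l)^*.
Proof.
rewrite conj_by_entry (bigD1 (j, l)) //= big1 ?addr0 => [|[a b] ab].
  by rewrite mxE !eqxx mulr1.
by rewrite mxE /= -xpair_eqE (negbTE ab) mulr0.
Qed.

Definition monomial_val (m : mpoly.multinom (N * N + N * N))
    (U : unitary R N) : Cplx R :=
  \prod_k (row_mx (mxvec (sval U)) (mxvec (map_mx Num.conj (sval U))) 0 k) ^+ m k.

(** Each entry is paired with a conjugate entry, a product that is an entry of a conjugated matrix
    unit; in degree below 2 the missing factors are the entry 1 of the conjugated identity at
    [(r0, r0)]. *)
Lemma balanced_monomial (m : mpoly.multinom (N * N + N * N)) (r0 : 'I_N) :
  (\sum_(k < N * N) m (lshift (N * N) k) =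
   \sum_(k < N * N) m (rshift (N * N) k))%N ->
  (\sum_(k < N * N) m (lshift (N * N) k) <= 2)%N ->
  exists (A B : 'M[Cplx R]_N) (i k a b : 'I_N), forall U,
    monomial_val m U = conj_by U A i k * conj_by U B a b.
Proof.
have [s [ss sE]] := prod_expn_seq (index_enum 'I_(N * N)) (fun k => m (lshift _ k)).
have [t [tt tE]] := prod_expn_seq (index_enum 'I_(N * N)) (fun k => m (rshift _ k)).
rewrite -ss -tt => st s2.
have mE U : monomial_val m U =
    (\prod_(x <- s) mxvec (sval U) 0 x) *
    (\prod_(x <- t) mxvec (map_mx Num.conj (sval U)) 0 x).
  rewrite -sE -tE /monomial_val big_split_ord /=.
  by congr (_ * _); apply: eq_bigr => x _; rewrite (row_mxEl, row_mxEr).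
have one U : conj_by U 1%:M r0 r0 = 1 by rewrite conj_by1 mxE eqxx.
case: s st s2 mE {ss sE tE} => [|x [|x' [|? ?]]] //;
  case: t {tt} => [|y [|y' [|? ?]]] // _ _ mE.
- by exists 1%:M, 1%:M, r0, r0, r0, r0 => U; rewrite mE !big_nil !one.
- case/mxvec_indexP: x mE => i j; case/mxvec_indexP: y => k l mE.
  exists (delta_mx j l), 1%:M, i, k, r0, r0 => U.
  by rewrite mE !big_seq1 one mulr1 conj_by_delta !mxvecE mxE.
- case/mxvec_indexP: x mE => i j; case/mxvec_indexP: y => k l.
  case/mxvec_indexP: x' => i' j'; case/mxvec_indexP: y' => k' l' mE.
  exists (delta_mx j l), (delta_mx j' l'), i, k, i', k' => U.
  by rewrite mE !big_cons !big_nil !mulr1 !conj_by_delta !mxvecE !mxE mulrACA.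
Qed.
End Monomials.

(** * Equality of the Clifford and Haar averages *)

Theorem mainTheorem9 (R : realType) (d n : nat)
    (mu : probability (unitary_borel R (qdim d n)) R)
    (d_prime : prime d) (d_gt2 : (2 < d)%N) (n_ge1 : (1 <= n)%N)
    (mu_haar : haar_measure mu) :
  finite_set (clifford_group R d n) /\
  unitary_design 2 mu (clifford_group R d n).
Proof.
split=> [|p p_bal rep repP]; first exact: finite_clifford_group.
pose D f := group_average rep f - cintegral mu f.
have Dsum (I : finType) (c : I -> Cplx R) (f : I -> unitary_borel R _ -> Cplx R) :
    (forall i, bounded_borel (f i)) ->
    D (fun U => \sum_i c i * f i U) = \sum_i c i * D (f i).
  move=> bf; rewrite /D group_average_sum // cintegral_sum; last first.
    by move=> i; apply: bounded_borelM => //; exact: bounded_borel_cst.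
  rewrite -sumrB; apply: eq_bigr => i _.
  by rewrite cintegralZ // mulrBr.
have Done : D (fun=> 1) = 0.
  by rewrite /D group_average_one // cintegral_cst subrr.
have Dinv V f : clifford R d n V -> bounded_borel f -> phase_invariant f ->
    D (fun U => f (umul V U)) = D f.
  by move=> cV bf fP; rewrite /D group_average_umul // cintegral_umul.
apply: subr0_eq; rewrite -[LHS]/(D (poly_val p)).
(* The support is indexed by ordinals because linearity of [D] is stated for sums over finite
   types. *)
pose s := in_tuple (msupp p).
rewrite (_ : poly_val p = fun U => \sum_(i < size (msupp p))
    mcoeff (tnth s i) p * monomial_val (tnth s i) U); last first.
  by apply/funext => U; rewrite /poly_val mevalE big_tnth.
pose r0 : 'I_(qdim d n) := Ordinal (qdim_gt0 d n).
have mE (i : 'I_(size (msupp p))) :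
  exists (A B : 'M[Cplx R]_(qdim d n)) (i' k a b : 'I_(qdim d n)),
    monomial_val (tnth s i) =
    (fun U => conj_by U A i' k * conj_by U B a b) :> (unitary R _ -> _).
  have [degE deg2] := p_bal _ (mem_tnth i s).
  have [A [B [i' [k [a [b E]]]]]] := balanced_monomial R r0 degE deg2.
  by exists A, B, i', k, a, b; apply/funext.
rewrite Dsum => [|i].
  apply: big1 => i _; have [A [B [i' [k [a [b ->]]]]]] := mE i.
  by rewrite (D_conj_by_eq0 d_prime d_gt2 n_ge1 Dsum Done Dinv) mulr0.
have [A [B [i' [k [a [b ->]]]]]] := mE i.
by apply: bounded_borelM; exact: bounded_borel_conj_by.
Qed.
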